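(* If $\tau\ge2$, then $\beta^*\le\Big(1+\dfrac{1}{\tau-1}\Big)\beta_1^*$.
   Context: $\mathbf{A}$ is an $n\times d$ real matrix with no zero row and no zero column, and $\mathbf{M}:=\mathbf{A}^\top\mathbf{A}$. The set $\{1,\dots,d\}$ is partitioned into $c$ sets $\mathcal{P}_1,\dots,\mathcal{P}_c$, each of size $s=d/c$. $\tau$ is an integer with $1\le\tau\le s$, and $s_1:=\max\{1,s-1\}$. For $\mathbf{G}\in\mathbb{R}^{d\times d}$, $D^{\mathbf{G}}$ denotes the diagonal matrix with $D^{\mathbf{G}}_{ii}=\mathbf{G}_{ii}$ for all $i$, and $B^{\mathbf{G}}$ denotes the $d\times d$ matrix with $B^{\mathbf{G}}_{ij}=\mathbf{G}_{ij}$ whenever $\{i,j\}\subset\mathcal{P}_l$ for some $l$, and $B^{\mathbf{G}}_{ij}=0$ otherwise. Define $$\sigma:=\max\{x^\top\mathbf{M}x: x\in\mathbb{R}^d,\ x^\top D^{\mathbf{M}}x\le1\},\qquad \sigma':=\max\{x^\top\mathbf{M}x: x\in\mathbb{R}^d,\ x^\top B^{\mathbf{M}}x\le1\},$$ $$\beta_1^*:=1+\frac{(\tau-1)(\sigma-1)}{s_1},\qquad \beta_2^*:=\Big(\frac{\tau}{s}-\frac{\tau-1}{s_1}\Big)\frac{\sigma'-1}{\sigma'}\,\sigma,\qquad \beta^*:=\beta_1^*+\beta_2^*.$$ *)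

(* Defs.v *)
From HB Require Import structures.
From mathcomp Require Import all_boot all_order all_algebra.
From mathcomp Require Import all_classical all_reals all_analysis.
From mathcomp Require Import ring lra.

Set Implicit Arguments.
Unset Strict Implicit.
Unset Printing Implicit Defensive.

Import Order.TTheory GRing.Theory Num.Theory.
Import numFieldNormedType.Exports.

Local Open Scope classical_set_scope.
Local Open Scope ring_scope.

Definition quad (R : realType) (d : nat) (G : 'M[R]_d) (x : 'cV[R]_d) : R :=
  (x^T *m G *m x) 0 0.

Definition diag_part (R : realType) (d : nat) (G : 'M[R]_d) : 'M[R]_d :=
  diag_mx (\row_i G i i).

Definition block_part (R : realType) (d : nat) (P : {set {set 'I_d}})
    (G : 'M[R]_d) : 'M[R]_d :=
  \matrix_(i, j) (if [exists S in P, [set i; j]%SET \subset S]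
                  then G i j else 0).

(* Written as a supremum; [sigma_max] and [sigma'_max] below show that it is
   attained, i.e. a maximum, for the forms of interest. *)
Definition quad_max (R : realType) (d : nat) (G W : 'M[R]_d) : R :=
  sup [set quad G x | x in [set x | quad W x <= 1]].

Definition sigma (R : realType) (d : nat) (M : 'M[R]_d) : R :=
  quad_max M (diag_part M).

Definition sigma' (R : realType) (d : nat) (P : {set {set 'I_d}})
    (M : 'M[R]_d) : R :=
  quad_max M (block_part P M).

Definition s_one (s : nat) : nat := maxn 1 (s - 1).

Definition beta1 (R : realType) (d : nat) (M : 'M[R]_d) (tau s : nat) : R :=
  1 + (tau%:R - 1) * (sigma M - 1) / (s_one s)%:R.

Definition beta2 (R : realType) (d : nat) (P : {set {set 'I_d}}) (M : 'M[R]_d)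
    (tau s : nat) : R :=
  (tau%:R / s%:R - (tau%:R - 1) / (s_one s)%:R)
  * ((sigma' P M - 1) / sigma' P M) * sigma M.

Definition beta (R : realType) (d : nat) (P : {set {set 'I_d}}) (M : 'M[R]_d)
    (tau s : nat) : R :=
  beta1 M tau s + beta2 P M tau s.

Section MaximumAttained.
Variable R : realType.

Lemma quad_form_continuous r (H : 'M[R]_r) :
  continuous (fun v : 'rV[R]_r => (v *m H *m v^T) 0 0).
Proof.
have -> : (fun v : 'rV[R]_r => (v *m H *m v^T) 0 0)
  = (fun v => \sum_(j < r) (\sum_(i < r) v 0 i * H i j) * v 0 j).
  apply/funext => v; rewrite mxE; apply: eq_bigr => j _.
  by rewrite !mxE.
apply: continuous_big => [|j _ v]; first exact: add_continuous.
apply: continuousM; last exact: coord_continuous.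
have : continuous (fun v : 'rV[R]_r => \sum_(i < r) v 0 i * H i j); last exact.
apply: continuous_big => [|i _ {}v]; first exact: add_continuous.
by apply: continuousM; [exact: coord_continuous|exact: cst_continuous].
Qed.

Lemma posdef_compact r (H : 'M[R]_r) :
  (forall v : 'rV_r, v != 0 -> 0 < (v *m H *m v^T) 0 0) ->
  compact [set v : 'rV[R]_r | (v *m H *m v^T) 0 0 <= 1].
Proof.
set g := fun v : 'rV[R]_r => (v *m H *m v^T) 0 0 => gpos.
have gc : continuous g by exact: quad_form_continuous.
have gZ a v : g (a *: v) = a ^+ 2 * g v.
  by rewrite /g linearZ /= -!scalemxAl -scalemxAr !mxE; ring.
have ncont : continuous (fun v : 'rV[R]_r => `|v|) by exact: norm_continuous.
pose S := [set v : 'rV[R]_r | `|v| = 1].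
have cS : compact S.
  apply: bounded_closed_compact.
    by exists 1; split => // x x1 v /= ->; exact: ltW.
  rewrite (_ : S = (fun v : 'rV[R]_r => `|v|) @^-1` [set 1]) //.
  by apply: preimage_closed => // *; exact: ncont.
have [m m0 mg] : exists2 m : R, 0 < m & forall v, m * `|v| ^+ 2 <= g v.
  have [S0|] := pselect (S !=set0); last first.
    move=> S0; exists 1 => // v.
    have [->|v0] := eqVneq v 0; last first.
      exfalso; apply: S0; exists (`|v|^-1 *: v); rewrite /S /= normrZ.
      by rewrite normfV normr_id mulVf // normr_eq0.
    by rewrite normr0 expr0n /= mulr0 /g mul0mx mul0mx mxE.
  have [c] : exists2 c, c \in S & forall t, t \in S -> g c <= g t.
    apply: compact_EVT_min => //; exact: continuous_subspaceT.
  rewrite inE => Sc gmin; exists (g c).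
    apply: gpos; apply/eqP => c0; move: Sc; rewrite /S /= c0 normr0 => /eqP.
    by rewrite eq_sym oner_eq0.
  move=> v; have [->|v0] := eqVneq v 0.
    by rewrite normr0 expr0n /= mulr0 /g mul0mx mul0mx mxE.
  have nv : `|v| != 0 by rewrite normr_eq0.
  have : g c <= g (`|v|^-1 *: v).
    by apply: gmin; rewrite inE /S /= normrZ normfV normr_id mulVf.
  rewrite gZ => h.
  rewrite -[leRHS](mulVKf (x := `|v| ^+ 2)) ?expf_neq0 //.
  by rewrite mulrC ler_wpM2l ?sqr_ge0 // -exprVn.
apply: bounded_closed_compact; last first.
  rewrite (_ : [set v | _] = g @^-1` [set x | x <= 1]) //.
  apply: (preimage_closed (f := g)); last exact: closed_le.
  by move=> w _; exact: gc.
exists (1 + m^-1); split; first by rewrite num_real.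
move=> x hx v /= gv.
have mv : `|v| ^+ 2 <= m^-1.
  by rewrite -(ler_pM2l m0) mulfV ?gt_eqF //; exact: le_trans (mg v) gv.
have mV : 0 < m^-1 by rewrite invr_gt0.
have := normr_ge0 v; nra.
Qed.

Lemma rv_sqr_eq0 r (u : 'rV[R]_r) : (u *m u^T) 0 0 = 0 -> u = 0.
Proof.
rewrite mxE => h; apply/rowP => i; rewrite mxE; apply/eqP.
have /eqP := h; rewrite psumr_eq0 => [/allP/(_ i)|j _]; last first.
  by rewrite mxE -expr2 sqr_ge0.
by rewrite mem_index_enum mxE -expr2 sqrf_eq0 => /(_ isT).
Qed.

Lemma quad_max_attained d (M W : 'M[R]_d) :
  M^T = M -> W^T = W -> (forall x, 0 <= quad W x) ->
  (forall x, quad W x = 0 -> W *m x = 0 /\ M *m x = 0) ->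
  exists2 x, quad W x <= 1 &
    quad M x = quad_max M W /\
    forall y, quad W y <= 1 -> quad M y <= quad M x.
Proof.
move=> Ms Ws W0 Wker; pose B := row_base W.
have formE (G : 'M[R]_d) (v : 'rV_(\rank W)) :
  quad G (v *m B)^T = (v *m (B *m G *m B^T) *m v^T) 0 0.
  by rewrite /quad trmxK trmx_mul !mulmxA.
have WW (u : 'rV_d) : u *m W *m W = 0 -> u *m W = 0.
  move=> h; apply: rv_sqr_eq0.
  by rewrite trmx_mul Ws mulmxA h mul0mx mxE.
have gpos (v : 'rV_(\rank W)) : v != 0 -> 0 < (v *m (B *m W *m B^T) *m v^T) 0 0.
  move=> v0; rewrite -formE lt_neqAle W0 andbT eq_sym.
  apply: contra_neq v0 => /Wker[h _].
  have /submxP[w hw] : (v *m B <= W)%MS.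
    by rewrite (submx_trans (submxMl _ _)) // eq_row_base.
  have : v *m B *m W = 0 by rewrite -[v *m B]trmxK -{2}Ws -trmx_mul h trmx0.
  rewrite hw => /WW; rewrite -hw => vB.
  by apply: (row_free_inj (row_base_free W)); rewrite -/B vB mul0mx.
have [c hc cmax] : exists2 c : 'rV[R]_(\rank W),
    c \in [set v : 'rV[R]_(\rank W) | (v *m (B *m W *m B^T) *m v^T) 0 0 <= 1] &
    forall t, t \in [set v : 'rV[R]_(\rank W) | (v *m (B *m W *m B^T) *m v^T) 0 0 <= 1] ->
    (t *m (B *m M *m B^T) *m t^T) 0 0 <= (c *m (B *m M *m B^T) *m c^T) 0 0.
  apply: EVT_max_rV.
  - by exists 0; rewrite /= mul0mx mul0mx mxE ler01.
  - exact: posdef_compact.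
  - exact/continuous_subspaceT/quad_form_continuous.
rewrite inE /= in hc.
have red x : exists2 v : 'rV_(\rank W),
    quad W (v *m B)^T = quad W x & quad M (v *m B)^T = quad M x.
  have sWW : (W <= W *m W)%MS.
    have := mxrank_mul_ker W W.
    have -> : (W :&: kermx W)%MS = 0.
      apply/eqP; rewrite -submx0; apply/row_subP => i.
      have := row_sub i (W :&: kermx W)%MS.
      rewrite sub_capmx => /andP[/submxP[w ->] /sub_kermxP /WW ->].
      exact: sub0mx.
    rewrite mxrank0 addn0 => rk.
    by have := mxrank_leqif_sup (submxMl W W); rewrite rk => -[_ <-].
  have /submxP[w hw] : (x^T *m W <= W *m W)%MS.
    by rewrite (submx_trans _ sWW) // submxMl.
  have /submxP[v hv] : (w *m W <= B)%MS by rewrite eq_row_base submxMl.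
  have Wk : W *m (x - (v *m B)^T) = 0.
    apply: trmx_inj; rewrite trmx_mul trmx0 linearB /= trmxK Ws.
    by rewrite mulmxBl hw -hv mulmxA subrr.
  have Mk : M *m (x - (v *m B)^T) = 0.
    by apply: (Wker _ _).2; rewrite /quad -mulmxA Wk mulmx0 mxE.
  have gen (G : 'M[R]_d) : G^T = G -> G *m (x - (v *m B)^T) = 0 ->
    quad G (v *m B)^T = quad G x.
    move=> Gs; rewrite mulmxBr => /eqP; rewrite subr_eq0 => /eqP h.
    have h' : x^T *m G = v *m B *m G.
      by apply: trmx_inj; rewrite [LHS]trmx_mul [RHS]trmx_mul trmxK Gs h.
    by rewrite /quad trmxK -h' -!mulmxA h.
  by exists v; exact: gen.
have feas : quad W (c *m B)^T <= 1 by rewrite formE.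
have xmax y : quad W y <= 1 -> quad M y <= quad M (c *m B)^T.
  have [v vW vM] := red y; rewrite -vW -vM !formE => hv.
  by apply: cmax; rewrite inE.
exists (c *m B)^T => //; split => //.
apply/eqP; rewrite eq_le; apply/andP; split.
  apply: ub_le_sup; last by exists (c *m B)^T.
  by exists (quad M (c *m B)^T) => _ [y hy <-]; exact: xmax.
apply: ge_sup; first by exists (quad M (c *m B)^T), (c *m B)^T.
by move=> _ [y hy <-]; exact: xmax.
Qed.

Lemma gram_max_attained n d (I : finType) (Q : {set I}) (F : I -> 'M[R]_(n, d))
    (A : 'M[R]_(n, d)) (W : 'M[R]_d) :
  A = \sum_(i in Q) F i -> W = \sum_(i in Q) (F i)^T *m F i ->
  exists2 x, quad W x <= 1 &
    quad (A^T *m A) x = quad_max (A^T *m A) W /\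
    forall y, quad W y <= 1 -> quad (A^T *m A) y <= quad (A^T *m A) x.
Proof.
move=> AE WE.
have qE x : quad W x = \sum_(i in Q) ((F i *m x)^T *m (F i *m x)) 0 0.
  rewrite /quad WE mulmx_sumr mulmx_suml summxE; apply: eq_bigr => i _.
  by rewrite trmx_mul !mulmxA.
have F0 x i : 0 <= ((F i *m x)^T *m (F i *m x)) 0 0.
  by rewrite mxE sumr_ge0 // => k _; rewrite mxE -expr2 sqr_ge0.
apply: quad_max_attained.
- by rewrite trmx_mul trmxK.
- rewrite WE linear_sum /=; apply: eq_bigr => i _.
  by rewrite trmx_mul trmxK.
- by move=> x; rewrite qE sumr_ge0.
move=> x /eqP; rewrite qE psumr_eq0 // => /allP h.
have Fx i : i \in Q -> F i *m x = 0.
  move=> iQ; have := h i (mem_index_enum i); rewrite iQ /= => /eqP hi.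
  apply: trmx_inj; rewrite trmx0; apply: rv_sqr_eq0.
  by rewrite trmxK.
split.
  by rewrite WE mulmx_suml big1 // => i iQ; rewrite -mulmxA Fx // mulmx0.
by rewrite -mulmxA {2}AE mulmx_suml big1 ?mulmx0 // => i iQ; rewrite Fx.
Qed.

Let col_restr n d (A : 'M[R]_(n, d)) (S : {set 'I_d}) : 'M[R]_(n, d) :=
  \matrix_(k, i) (if i \in S then A k i else 0).

Let col_restr_gram n d (A : 'M[R]_(n, d)) (S : {set 'I_d}) i j :
  ((col_restr A S)^T *m col_restr A S) i j
  = if (i \in S) && (j \in S) then (A^T *m A) i j else 0.
Proof.
rewrite mxE; case: ifP => [/andP[iS jS]|/negbT ijS].
  by rewrite [RHS]mxE; apply: eq_bigr => k _; rewrite !mxE iS jS.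
rewrite big1 // => k _; rewrite !mxE.
by move: ijS; case: (i \in S); case: (j \in S); rewrite ?mulr0 ?mul0r.
Qed.

Lemma sigma_max n d (A : 'M[R]_(n, d)) (M := A^T *m A) :
  exists2 x, quad (diag_part M) x <= 1 &
    quad M x = sigma M /\
    forall y, quad (diag_part M) y <= 1 -> quad M y <= quad M x.
Proof.
apply: (@gram_max_attained _ _ _ [set: 'I_d]%SET
          (fun i => col_restr A [set i]%SET)).
  apply/matrixP => k i; rewrite summxE (bigD1 i) ?inE //= big1 ?addr0.
    by rewrite mxE inE eqxx.
  by move=> j /andP[_ /negbTE ji]; rewrite mxE inE eq_sym ji.
apply/matrixP => i j; rewrite summxE (bigD1 i) ?inE //= big1 ?addr0.
  by rewrite col_restr_gram !inE !mxE eqxx /= eq_sym; case: eqP => // ->.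
move=> k /andP[_ /negbTE ki].
by rewrite col_restr_gram !inE eq_sym ki.
Qed.

Lemma sigma'_max n d (A : 'M[R]_(n, d)) (P : {set {set 'I_d}})
    (M := A^T *m A) :
  finset.partition P [set: 'I_d]%SET ->
  exists2 x, quad (block_part P M) x <= 1 &
    quad M x = sigma' P M /\
    forall y, quad (block_part P M) y <= 1 -> quad M y <= quad M x.
Proof.
move=> /and3P[/eqP cP tP _].
have uni S T i : S \in P -> T \in P -> i \in S -> i \in T -> S = T.
  by move=> SP TP iS iT; rewrite -(def_pblock tP SP iS) (def_pblock tP TP iT).
apply: (@gram_max_attained _ _ _ P (col_restr A)).
  apply/matrixP => k i; rewrite summxE.
  have : i \in finset.cover P by rewrite cP inE.
  move=> /finset.bigcupP[S SP iS]; rewrite (bigD1 S) //= big1 ?addr0.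
    by rewrite mxE iS.
  move=> T /andP[TP TS]; rewrite mxE; case: ifP => // iT.
  by rewrite (uni T S i) ?eqxx in TS.
apply/matrixP => i j; rewrite summxE mxE.
under eq_bigr do rewrite col_restr_gram.
case: ifP => [/existsP[S /andP[SP]]|/negbT/existsPn h].
  rewrite finset.subUset !finset.sub1set => /andP[iS jS]; rewrite (bigD1 S) //= iS jS.
  rewrite big1 ?addr0 // => T /andP[TP TS]; case: ifP => // /andP[iT _].
  by rewrite (uni T S i) ?eqxx in TS.
rewrite big1 // => S SP; case: ifP => // /andP[iS jS].
by have := h S; rewrite SP finset.subUset !finset.sub1set iS jS.
Qed.

End MaximumAttained.

(* Main.v *)
Require Import Defs.
From mathcomp Require Import all_boot all_order all_algebra.
From mathcomp Require Import reals.
From mathcomp Require Import ring lra.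

Import Order.TTheory GRing.Theory Num.Theory.
Local Open Scope ring_scope.

(** Since [beta = beta1 + beta2], the claim is [beta2 <= beta1 / (tau - 1)].
    As [2 <= tau <= s], [s_one s] is [s - 1], and the right-hand side is
    [1 / (tau - 1) + (sigma - 1) / (s - 1)].  On the left,
      [tau / s - (tau - 1) / (s - 1) = ((s - tau) / s) * (1 / (s - 1))]
    lies between [0] and [1 / (s - 1)] (lemma [coef_bounds]), and the factor
    [(sigma' - 1) / sigma'] is at most [1] because [sigma' >= 0]
    (lemma [sigma'_ge0]).  Therefore [beta2 <= sigma / (s - 1)
    = 1 / (s - 1) + (sigma - 1) / (s - 1)], and [1 / (s - 1) <= 1 / (tau - 1)].
    Multiplying by [sigma] uses its sign, which comes from evaluating the form
    at a normalized basis vector (lemma [sigma_ge1]); that vector exists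
    because no column of [A] vanishes. *)

Lemma quad_scale_delta (R : realType) (d : nat) (G : 'M[R]_d) (a : R)
    (j : 'I_d) :
  quad G (a *: delta_mx j 0) = a ^+ 2 * G j j.
Proof.
rewrite /quad -scalemxAr [(a *: _)^T]linearZ /= -!scalemxAl trmx_delta.
by rewrite -rowE -colE !mxE mulrA expr2.
Qed.

(** The diagonal entries of a Gram matrix are the squared norms of the
    columns. *)
Lemma gram_diag_gt0 (R : realType) (n d : nat) (A : 'M[R]_(n, d)) (j : 'I_d) :
  col j A != 0 -> 0 < (A^T *m A) j j.
Proof.
have -> : (A^T *m A) j j = ((col j A)^T *m ((col j A)^T)^T) 0 0.
  by rewrite !mxE; apply: eq_bigr => k _; rewrite !mxE.
move=> Aj0; rewrite lt_neqAle; apply/andP; split.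
  apply: contra_neq Aj0 => /esym/rv_sqr_eq0 Aj0.
  by apply: trmx_inj; rewrite Aj0 trmx0.
by rewrite mxE sumr_ge0 // => k _; rewrite !mxE -expr2 sqr_ge0.
Qed.

(** On a coordinate axis a form and its diagonal part agree, so the basis
    vector scaled to the boundary of the constraint has value exactly [1]. *)
Lemma sigma_ge1 (R : realType) (n d : nat) (A : 'M[R]_(n, d)) (j : 'I_d) :
  col j A != 0 -> 1 <= sigma (A^T *m A).
Proof.
move=> /gram_diag_gt0; set m := (A^T *m A) j j => m_gt0.
have [x _ [<- xmax]] := sigma_max A.
have unit_value : (Num.sqrt m)^-1 ^+ 2 * m = 1.
  by rewrite exprVn sqr_sqrtr ?ltW // mulVf // gt_eqF.
have diag_entry : diag_part (A^T *m A) j j = m.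
  by rewrite mxE mxE eqxx mulr1n.
have := xmax ((Num.sqrt m)^-1 *: delta_mx j 0).
rewrite !quad_scale_delta diag_entry -/m.
by rewrite unit_value lexx; apply.
Qed.

Lemma sigma'_ge0 (R : realType) (n d : nat) (A : 'M[R]_(n, d))
    (P : {set {set 'I_d}}) :
  finset.partition P [set: 'I_d]%SET -> 0 <= sigma' P (A^T *m A).
Proof.
move=> /(sigma'_max A)[x _ [<- xmax]].
have quad0 (G : 'M[R]_d) : quad G 0 = 0 by rewrite /quad mulmx0 mxE.
by have := xmax 0; rewrite !quad0 ler01; apply.
Qed.

Lemma coef_bounds (F : realFieldType) (s t : F) : 1 < s -> 0 <= t <= s ->
  0 <= t / s - (t - 1) / (s - 1) <= 1 / (s - 1).
Proof.
move=> s_gt1 /andP[t_ge0 t_les].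
have s_gt0 : 0 < s by lra.
have s1_gt0 : 0 < s - 1 by lra.
have -> : t / s - (t - 1) / (s - 1) = (s - t) / s * (1 / (s - 1)).
  by field; rewrite !gt_eqF.
have s1V_ge0 : 0 <= 1 / (s - 1) by rewrite divr_ge0 // ltW.
have st_ge0 : 0 <= (s - t) / s by rewrite divr_ge0 ?subr_ge0 // ltW.
apply/andP; split; first exact: mulr_ge0.
by rewrite ler_piMl // ler_pdivrMr // mul1r gerBl.
Qed.

Lemma div_pred_le1 (F : realFieldType) (q : F) : 0 <= q -> (q - 1) / q <= 1.
Proof.
rewrite le_eqVlt => /predU1P[<-|q_gt0].
  by rewrite invr0 mulr0.
by rewrite ler_pdivrMr // mul1r gerBl.
Qed.

Theorem lemma5 (R : realType) (n d c s tau : nat)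
  (A : 'M[R]_(n, d)) (P : {set {set 'I_d}})
  (A_row : forall i : 'I_n, row i A != 0)
  (A_col : forall j : 'I_d, col j A != 0)
  (P_part : finset.partition P [set: 'I_d]%SET)
  (c_gt0 : (0 < c)%N)
  (P_card : #|P| = c)
  (block_card : forall S : {set 'I_d}, S \in P -> #|S| = s)
  (d_eq : d = (c * s)%N)
  (tau_bounds : (1 <= tau <= s)%N)
  (tau_ge2 : (2 <= tau)%N) :
  beta P (A^T *m A) tau s
  <= (1 + 1 / (tau%:R - 1)) * beta1 (A^T *m A) tau s.
Proof.
have /andP[_ tau_le_s] := tau_bounds.
have s_ge2 : (2 <= s)%N := leq_trans tau_ge2 tau_le_s.
have d_gt0 : (0 < d)%N by rewrite d_eq muln_gt0 c_gt0 (ltnW s_ge2).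
have sig_ge1 := sigma_ge1 _ _ _ _ _ (A_col (Ordinal d_gt0)).
have factor_le1 := div_pred_le1 _ _ (sigma'_ge0 _ _ _ A P P_part).
have s_oneE : (s_one s)%:R = s%:R - 1 :> R.
  by rewrite /s_one (maxn_idPr _) ?subn_gt0 // natrB // ltnW.
rewrite /beta /beta2 /beta1 s_oneE.
move: (sigma _) (_ / sigma' _ _) sig_ge1 factor_le1 => sig q sig_ge1 q_le1.
have t_ge2 : 2 <= tau%:R :> R by rewrite ler_nat.
have t_le_s : tau%:R <= s%:R :> R by rewrite ler_nat.
move: (tau%:R) (s%:R) t_ge2 t_le_s => t r t_ge2 t_le_r.
have [||C_ge0 C_le] := andP (coef_bounds _ r t _ _); [lra | lra |].
set C := t / r - _ in C_ge0 C_le *.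
have t1_gt0 : 0 < t - 1 by lra.
have r1_gt0 : 0 < r - 1 by lra.
have -> : (1 + 1 / (t - 1)) * (1 + (t - 1) * (sig - 1) / (r - 1))
    = (1 + (t - 1) * (sig - 1) / (r - 1))
      + (1 / (t - 1) + (sig - 1) / (r - 1)).
  by field; rewrite !gt_eqF.
rewrite lerD2l.
apply: (@le_trans _ _ (1 / (r - 1) * sig)).
  apply: ler_wpM2r; first lra.
  by apply: le_trans C_le; rewrite ler_piMr.
have -> : 1 / (r - 1) * sig = 1 / (r - 1) + (sig - 1) / (r - 1).
  by field; rewrite gt_eqF.
by rewrite lerD2r !div1r lef_pV2 // lerD2r.
Qed.
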